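(* Let $p\in(1,2)$. There exist constants $C,D>0$ (depending only on $p$) such that for all integers $n>1$, $$C\Big(\frac{\log n}{n}\Big)^{\frac{2-p}{2p}}\le r_p^n(\mathbb C)\le D\Big(\frac{\log n}{n}\Big)^{\frac{2-p}{2p}}.$$
   Context: For a complex Banach space $X$, $p\in[1,\infty)$ and a holomorphic $f:\mathbb D^n\to X$ ($\mathbb D^n$ the open unit polydisk), $f(z)=x_0+\sum_{|\alpha|\ge1}x_\alpha z^\alpha$ (multi-index notation), with $\sup_{z\in\mathbb D^n}\|f(z)\|\le1$, let $r_p^n(f,X)=\sup\{r\ge0:\|x_0\|^p+\sum_{k\ge1}\sum_{|\alpha|=k}\|x_\alpha z^\alpha\|^p\le1\ \forall z\in r\mathbb D^n\}$ and $r_p^n(X)=\inf$ of $r_p^n(f,X)$ over all such $f$ (the $n$-dimensional $p$-Bohr radius). *)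

(* Defs.v *)
From HB Require Import structures.
From mathcomp Require Import all_boot all_order all_algebra.
From mathcomp Require Import all_classical all_reals all_analysis.
From mathcomp Require Import complex.
Set Implicit Arguments. Unset Strict Implicit. Unset Printing Implicit Defensive.
Import Order.TTheory GRing.Theory Num.Theory.
Import numFieldNormedType.Exports.
Local Open Scope classical_set_scope.
Local Open Scope ring_scope.
Local Open Scope complex_scope.

Definition multi_index (n : nat) := {ffun 'I_n -> nat}.

Section Bohr.
Variable R : realType.
Local Notation C := R[i].

Definition cmod (x : C) : R := ComplexField.Normc.normc x.

Definition monom n (z : 'I_n -> C) (a : multi_index n) : C := \prod_(i < n) z i ^+ a i.

Definition in_polydisk n (r : R) (z : 'I_n -> C) : Prop := forall i, cmod (z i) < r.

Definition box_psum n (c : multi_index n -> C) (z : 'I_n -> C) (N : nat) : C :=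
  \sum_(a : {ffun 'I_n -> 'I_N.+1})
     c [ffun i => nat_of_ord (a i)] * monom z [ffun i => nat_of_ord (a i)].

(* c is the coefficient family of a holomorphic f : D^n -> C (f(z) = sum_alpha c_alpha z^alpha,
   absolutely convergent on D^n) with sup_{z in D^n} |f(z)| <= 1. *)
Definition holo_unit_ball n (c : multi_index n -> C) : Prop :=
  (forall z, in_polydisk 1 z ->
     (\esum_(a in [set: multi_index n]) (cmod (c a * monom z a))%:E < +oo)%E) /\
  (forall z, in_polydisk 1 z ->
     exists l : C^o, (box_psum c z N : C^o) @[N --> \oo] --> l /\ cmod l <= 1).

Definition p_majorant n (p : R) (c : multi_index n -> C) (z : 'I_n -> C) : \bar R :=
  \esum_(a in [set: multi_index n]) ((cmod (c a * monom z a)) `^ p)%:E.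

(* r_p^n(f, C), as an extended real (it is +oo e.g. for unimodular constants) *)
Definition bohr_radius_f n (p : R) (c : multi_index n -> C) : \bar R :=
  ereal_sup [set r%:E | r in [set r : R | 0 <= r /\
     forall z, in_polydisk r z -> (p_majorant p c z <= 1)%E]].

Definition bohr_radius n (p : R) : \bar R :=
  ereal_inf [set bohr_radius_f p c | c in [set c : multi_index n -> C | holo_unit_ball c]].

End Bohr.

(* Main.v *)
Require Import Defs.
From HB Require Import structures.
From mathcomp Require Import all_boot all_order all_algebra.
From mathcomp Require Import all_classical all_reals all_analysis.
From mathcomp Require Import complex cyclic separable cyclotomic.
From mathcomp Require Import zify ring lra.
(**
  Put x = log n / (4 n), so that the exponent of the theorem gives the scale
  x^((2-p)/(2p)).

  Lower bound. Let f = sum c_a z^a be bounded by 1. By the Caratheodory type estimate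
  |q_m| <= 2 (B - |q_0|) for polynomials, every homogeneous part P_m of f is at most
  2 (1 - |c_0|), up to factors 2^m. Reading off the coefficient of l in P_m (z_i (1 + l u_i))
  for unimodular u_i bounds sum_i |z_i d_i P_m| on the torus by C^m (1 - |c_0|), and the
  comparison of the L^1 and L^2 norms of homogeneous polynomials turns this into a bound for
  sum_i (sum_a a_i^2 |c_a|^2)^(1/2). Only (number of monomials of degree m involving z_i)
  <= x^(-m) coefficients enter the i-th term, so that Hoelder's inequality gives
  sum_(|a| = m) (|c_a| r^m)^p <= (1 - |c_0|) 2^(-m) for r a small multiple of the scale.
  All norms are averages over grids of roots of unity, and f is replaced by a partial sum
  over a box which is bounded by 1 + e.

  Upper bound. With m = log_2 n and k = n / m, the polynomial
  sum_w prod_j omega^(w_j w_(j+1)) prod_j z_(j, w_j) over the words w of length m on k letters,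
  omega a primitive k-th root of unity, has k^m unimodular coefficients and is at most
  k^((m+1)/2) on the polydisk, as a product of diagonal contractions and Fourier matrices.
*)

Set Implicit Arguments.
Unset Strict Implicit.
Unset Printing Implicit Defensive.
Import Order.TTheory GRing.Theory Num.Theory.
Local Open Scope ring_scope.

(** * Finite Fourier analysis over roots of unity, and a Caratheodory type coefficient bound *)

Section Fourier.
Variable C : numClosedFieldType.
Implicit Types x y w : C.

Lemma closed_prim_root_exists M : (0 < M)%N -> exists w, M.-primitive_root w.
Proof.
move=> M_gt0; pose p : {poly C} := 'X^M - 1; have [r Dp] := closed_field_poly_normal p.
rewrite (monicP _) ?monicXnsubC // scale1r in Dp.
have r1 : all M.-unity_root r by apply/allP => z; rewrite -root_prod_XsubC -Dp.
have sz_r : (M < (size r).+1)%N by rewrite -(size_prod_XsubC r id) -Dp size_XnsubC.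
have [|w] := hasP (has_prim_root M_gt0 r1 _ sz_r); last by exists w.
by rewrite -separable_prod_XsubC -Dp separable_Xn_sub_1 // pnatr_eq0 -lt0n.
Qed.

Lemma norm_prim_root M w : M.-primitive_root w -> `|w| = 1.
Proof.
move=> wP; apply/eqP; rewrite -(@pexpr_eq1 _ _ M) ?normr_ge0 ?(prim_order_gt0 wP) //.
by rewrite -normrX (prim_expr_order wP) normr1.
Qed.

Lemma conj_prim_root M w : M.-primitive_root w -> w^* = w^-1.
Proof. by move=> wP; rewrite invC_norm (norm_prim_root wP) expr1n invr1 mul1r. Qed.

Lemma sum_prim_root M w a b : M.-primitive_root w ->
  \sum_(t < M) w ^+ (a * t) * (w ^+ (b * t))^* = if a == b %[mod M] then M%:R else 0.
Proof.
move=> wP; have w0 : w != 0 by rewrite -normr_eq0 (norm_prim_root wP) oner_eq0.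
pose u := w ^+ a / w ^+ b.
have -> : \sum_(t < M) w ^+ (a * t) * (w ^+ (b * t))^* = \sum_(t < M) u ^+ t.
  apply: eq_bigr => t _; rewrite rmorphXn /= (conj_prim_root wP) exprVn.
  by rewrite /u expr_div_n -!exprM.
have u1 : (u == 1) = (a == b %[mod M]).
  by rewrite -(eq_prim_root_expr wP) /u -subr_eq0 -(mulfV (expf_neq0 b w0)) -mulrBl mulf_eq0
       invr_eq0 (expf_eq0 w) (negPf w0) andbF orbF subr_eq0.
rewrite -u1; have [->|un1] := eqVneq u 1.
  by rewrite (eq_bigr (fun=> 1)) ?sumr_const ?card_ord // => t _; rewrite expr1n.
have /eqP: (u - 1) * \sum_(t < M) u ^+ t = 0.
  rewrite -subrX1 /u expr_div_n -!exprM ![(_ * M)%N]mulnC !exprM.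
  by rewrite (prim_expr_order wP) !expr1n divr1 subrr.
by rewrite mulf_eq0 subr_eq0 (negPf un1) => /eqP.
Qed.

Lemma sum_prim_root_eq0 M w a : M.-primitive_root w -> ~~ (M %| a)%N ->
  \sum_(t < M) w ^+ (a * t) = 0.
Proof.
move=> wP aM; have := sum_prim_root a 0 wP.
rewrite mod0n -/(dvdn M a) (negPf aM) => /= h; rewrite -[RHS]h.
by apply: eq_bigr => t _; rewrite mul0n expr0 rmorph1 mulr1.
Qed.

(** An arbitrary orthogonal family is allowed, so that the identity serves both the monomials on a
    grid of roots of unity and the rows of a Fourier matrix. *)
Lemma parseval (I T : finType) (chi : I -> T -> C) (K : C) (c : I -> C) :
  (forall i j, \sum_t chi i t * (chi j t)^* = if i == j then K else 0) ->
  \sum_t `|\sum_i c i * chi i t| ^+ 2 = K * \sum_i `|c i| ^+ 2.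
Proof.
move=> ortho.
have -> : \sum_t `|\sum_i c i * chi i t| ^+ 2 =
    \sum_t \sum_i \sum_j c i * (c j)^* * (chi i t * (chi j t)^*).
  apply: eq_bigr => t _; rewrite normCK rmorph_sum mulr_suml; apply: eq_bigr => i _.
  by rewrite mulr_sumr; apply: eq_bigr => j _; rewrite rmorphM /= mulrACA.
rewrite exchange_big mulr_sumr; apply: eq_bigr => i _ /=.
rewrite exchange_big (bigD1 i) //= -mulr_sumr ortho eqxx normCK mulrC.
rewrite big1 ?addr0 // => j /negPf ji.
by rewrite -mulr_sumr ortho eq_sym ji mulr0.
Qed.

Lemma phase x : exists2 u, `|u| = 1 & u * x = `|x|.
Proof.
have [->|x0] := eqVneq x 0; first by exists 1; rewrite ?normr1 ?normr0 ?mulr0.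
have nx0 : `|x| != 0 by rewrite normr_eq0.
exists (`|x| / x); last by rewrite divfK.
by rewrite normrM normfV normr_id divff.
Qed.

(** Choose unimodular u and v with u x and v y nonnegative; for the phase v / u nothing cancels in
    the sum. *)
Lemma le_norm_add_phase x y B :
  (forall v, `|v| = 1 -> `|x + v * y| <= B) -> `|x| + `|y| <= B.
Proof.
move=> H; have [u u1 ux] := phase x; have [v v1 vy] := phase y.
have u0 : u != 0 by rewrite -normr_eq0 u1 oner_eq0.
have := H (v / u); rewrite normrM normfV u1 v1 divr1 => /(_ erefl).
have -> : x + v / u * y = (`|x| + `|y|) / u.
  by rewrite -ux -vy; field; rewrite u0.
by rewrite normrM normfV u1 divr1 ger0_norm ?addr_ge0.
Qed.

(* Average q against the nonnegative kernel |1 + v w^m|^2 over roots of unity. *)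
Lemma poly_coef_le (q : {poly C}) (B : C) m : (0 < m)%N ->
  (forall z, `|z| = 1 -> `|q.[z]| <= B) -> `|q`_m| <= 2 * (B - `|q`_0|).
Proof.
(* Enough points to avoid aliasing: for s < [size q], both s and s + m stay below M, so the discrete
   sums return exact coefficients. *)
move=> m0 qB; pose M := (size q + m).+1.
have M0 : (0 < M)%N by [].
have [w wP] := closed_prim_root_exists M0.
have w1 t : `|w ^+ t| = 1 by rewrite normrX (norm_prim_root wP) expr1n.
suff: `|2 * q`_0| + `|q`_m| <= 2 * B.
  by rewrite normrM normr_nat => h; rewrite mulrBr lerBrDl.
apply: le_norm_add_phase => v v1.
pose X t := v * (w ^+ (m * t))^*.
have X1 t : `|X t| = 1 by rewrite normrM norm_conjC w1 v1 mulr1.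
have kE t : `|1 + X t| ^+ 2 = 2 + X t + v^* * w ^+ (m * t).
  have Xc : (X t)^* = v^* * w ^+ (m * t) by rewrite rmorphM /= conjCK.
  rewrite normCK rmorphD rmorph1 -Xc.
  have -> : (1 + X t) * (1 + (X t)^*) = 1 + X t + (X t)^* + X t * (X t)^* by ring.
  by rewrite -normCK X1 expr1n; ring.
have qE t : q.[w ^+ t] = \sum_(s < size q) q`_s * w ^+ (s * t).
  by rewrite horner_coef; apply: eq_bigr => s _; rewrite -exprM mulnC.
have fourier a : (a < M)%N -> \sum_(t < M) q.[w ^+ t] * (w ^+ (a * t))^* = M%:R * q`_a.
  move=> aM; under eq_bigr do rewrite qE mulr_suml.
  rewrite exchange_big /=.
  transitivity (\sum_(s < size q) if (s : nat) == a then M%:R * q`_a else 0).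
    apply: eq_bigr => s _; under eq_bigr do rewrite -mulrA.
    rewrite -mulr_sumr sum_prim_root //.
    rewrite !modn_small //; last by rewrite ltnS ltnW // (leq_trans (ltn_ord s)) ?leq_addr.
    by case: eqP => [->|]; rewrite ?mulr0 // mulrC.
  rewrite -big_mkcond; case: (ltnP a (size q)) => [asz|sza].
    by rewrite (big_pred1 (Ordinal asz)) // => s; apply/eqP/eqP => [e|-> //]; apply: val_inj.
  rewrite nth_default // mulr0 big_pred0 // => s.
  by apply/eqP => e; move: (ltn_ord s); rewrite e ltnNge sza.
have fourierN : \sum_(t < M) q.[w ^+ t] * w ^+ (m * t) = 0.
  under eq_bigr do rewrite qE mulr_suml.
  rewrite exchange_big /= big1 // => s _.
  under eq_bigr => t _ do rewrite -mulrA -exprD -mulnDl.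
  rewrite -mulr_sumr sum_prim_root_eq0 ?mulr0 //.
  by rewrite gtnNdvd ?addn_gt0 ?m0 ?orbT // ltnS leq_add2r ltnW.
have kernel_sum : \sum_(t < M) `|1 + X t| ^+ 2 = 2 * M%:R.
  under eq_bigr do rewrite kE.
  rewrite !big_split /= sumr_const card_ord -mulr_sumr -/X.
  have h : \sum_(t < M) w ^+ (m * t) = 0.
    by apply: sum_prim_root_eq0 => //; rewrite gtnNdvd // ltnS leq_addl.
  rewrite /X -mulr_sumr -rmorph_sum /= h rmorph0 !mulr0 !addr0.
  by ring.
have main : \sum_(t < M) q.[w ^+ t] * `|1 + X t| ^+ 2 = M%:R * (2 * q`_0 + v * q`_m).
  under eq_bigr => t _ do rewrite kE /X 2!mulrDr (mulrC _ 2) !(mulrCA _ v) (mulrCA _ v^*).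
  rewrite !big_split /= -!mulr_sumr fourierN fourier; last by rewrite /M; lia.
  have := fourier 0 M0; under eq_bigr do rewrite mul0n expr0 rmorph1 mulr1.
  by move=> ->; ring.
have MR : 0 < M%:R :> C by rewrite ltr0n.
rewrite -(ler_pM2l MR) -{1}(ger0_norm (ltW MR)) -normrM -main.
apply: le_trans (ler_norm_sum _ _ _) _.
have -> : M%:R * (2 * B) = \sum_(t < M) B * `|1 + X t| ^+ 2.
  by rewrite -mulr_sumr kernel_sum; ring.
apply: ler_sum => t _; rewrite normrM (ger0_norm (exprn_ge0 _ (normr_ge0 _))).
by rewrite ler_wpM2r ?exprn_ge0 ?qB.
Qed.

End Fourier.

(** * First-order coefficients of products of polynomials *)

Lemma coef01_prod (A : comNzRingType) (I : Type) (r : seq I) (f : I -> {poly A}) :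
  (forall i, (f i)`_0 = 1) ->
  (\prod_(i <- r) f i)`_0 = 1 /\ (\prod_(i <- r) f i)`_1 = \sum_(i <- r) (f i)`_1.
Proof.
move=> f1; elim: r => [|i r [IH0 IH1]].
  by rewrite !big_nil !coefC.
rewrite !big_cons coef0M f1 IH0 mulr1; split=> //.
by rewrite coefM !big_ord_recl big_ord0 /= f1 IH0 IH1 mul1r mulr1 addr0 addrC.
Qed.

Lemma coef1_expX (A : comNzRingType) (u : A) k :
  ((1 + u *: 'X : {poly A}) ^+ k)`_0 = 1 /\ ((1 + u *: 'X : {poly A}) ^+ k)`_1 = k%:R * u.
Proof.
have f0 (_ : 'I_k) : (1 + u *: 'X : {poly A})`_0 = 1 by rewrite coefD coefZ coefX coefC mulr0 addr0.
have [h0 h1] := coef01_prod (index_enum 'I_k) f0.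
move: h0 h1; rewrite prodr_const sumr_const card_ord => -> ->; split=> //.
by rewrite coefD coefZ coefX coefC add0r mulr1 mulr_natl.
Qed.

(** * Homogeneous parts of a polynomial and their Euler derivatives *)

Section Homogeneous.
Variables (R : realType) (n N : nat).
Local Notation C := R[i].
Local Notation T := {ffun 'I_n -> 'I_N.+1}.
Implicit Types (b : T -> C) (z : 'I_n -> C) (a : T).

Definition mdeg (a : multi_index n) := (\sum_i a i)%N.

Definition box_index a : multi_index n := [ffun i => nat_of_ord (a i)].

Definition hom_part b m z : C :=
  \sum_(a | mdeg (box_index a) == m) b a * monom z (box_index a).

Lemma monomM z z' (a : multi_index n) :
  monom (fun i => z i * z' i) a = monom z a * monom z' a.
Proof. by rewrite /monom -big_split; apply: eq_bigr => i _; rewrite exprMn. Qed.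

Lemma monom_cst (s : C) (a : multi_index n) : monom (fun=> s) a = s ^+ mdeg a.
Proof. by rewrite /monom prodrXr. Qed.

Lemma mdeg_box_eq0 a : (mdeg (box_index a) == 0) = (a == [ffun=> ord0]).
Proof.
rewrite /mdeg sum_nat_eq0; apply/forallP/eqP => [h|-> i]; last by rewrite !ffunE.
by apply/ffunP => i; have := h i; rewrite !ffunE /= => /eqP e; apply: val_inj.
Qed.

(** Along the disc w z, with w a scalar, the homogeneous parts are the coefficients of a polynomial
    in w, to which [poly_coef_le] applies. *)
Lemma hom_part_le b (B : C) m z : (0 < m)%N ->
  (forall z, (forall i, `|z i| <= 2^-1) -> `|\sum_a b a * monom z (box_index a)| <= B) ->
  (forall i, `|z i| <= 2^-1) ->
  `|hom_part b m z| <= 2 * (B - `|b [ffun=> ord0]|).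
Proof.
move=> m0 bB zB.
pose q : {poly C} := \sum_a (b a * monom z (box_index a)) *: 'X^(mdeg (box_index a)).
have qE k : q`_k = hom_part b k z.
  rewrite coef_sum [RHS]big_mkcond /=; apply: eq_bigr => a _.
  by rewrite coefZ coefXn eq_sym; case: eqP => _; rewrite ?mulr1 ?mulr0.
have q0 : q`_0 = b [ffun=> ord0].
  rewrite qE /hom_part (big_pred1 [ffun=> ord0]) => [|a]; last exact: mdeg_box_eq0.
  by rewrite /monom big1 ?mulr1 // => i _; rewrite !ffunE expr0.
rewrite -qE -q0; apply: poly_coef_le => // w w1.
have -> : q.[w] = \sum_a b a * monom (fun i => w * z i) (box_index a).
  rewrite horner_sum; apply: eq_bigr => a _.
  by rewrite hornerZ hornerXn monomM monom_cst mulrAC mulrA.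
by apply: bB => i; rewrite normrM w1 mul1r.
Qed.

(* The sum over [i], with unimodular weights [u i], is the coefficient of [l] in
   [hom_part b m (fun i => (1 + l * u i) * z i)]. *)
Lemma sum_norm_euler_le b (A : C) m z :
  (forall z, (forall i, `|z i| <= 2^-1) -> `|hom_part b m z| <= A) ->
  (forall i, `|z i| <= 4^-1) ->
  \sum_i `|hom_part (fun a => (a i)%:R * b a) m z| <= 2 * A.
Proof.
move=> bA zB.
pose Q i := hom_part (fun a => (a i)%:R * b a) m z.
pose u i := projT1 (cid2 (phase (Q i))).
have u1 i : `|u i| = 1 by rewrite /u; case: cid2.
have uQ i : u i * Q i = `|Q i| by rewrite /u; case: cid2.
pose q : {poly C} := \sum_(a | mdeg (box_index a) == m)
  (b a * monom z (box_index a)) *: \prod_i (1 + u i *: 'X) ^+ a i.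
have q1 : q`_1 = \sum_i `|Q i|.
  rewrite coef_sum; under [RHS]eq_bigr do rewrite -uQ /Q /hom_part mulr_sumr.
  rewrite exchange_big /=; apply: eq_bigr => a _.
  rewrite coefZ (coef01_prod _ _).2 => [|i]; last exact: (coef1_expX _ _).1.
  rewrite mulr_sumr; apply: eq_bigr => i _.
  by rewrite (coef1_expX _ _).2; ring.
have qz w : q.[w] = hom_part b m (fun i => (1 + w * u i) * z i).
  rewrite horner_sum; apply: eq_bigr => a _.
  rewrite hornerZ horner_prod monomM mulrAC -mulrA; congr (_ * (_ * _)).
  by rewrite /monom; apply: eq_bigr => i _; rewrite !hornerE ffunE (mulrC w).
have q1A : `|q`_1| <= 2 * (A - `|q`_0|).
  apply: poly_coef_le => // w w1; rewrite qz; apply: bA => i; rewrite normrM.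
  have -> : 2^-1 = 2 * 4^-1 :> C by field.
  apply: ler_pM => //; apply: le_trans (ler_normD _ _) _.
  by rewrite normrM w1 u1 normr1 mulr1.
rewrite -/(Q _) (_ : \sum_i _ = `|q`_1|); last first.
  by rewrite q1 ger0_norm // sumr_ge0.
by apply: le_trans q1A _; rewrite ler_pM2l // gerBl.
Qed.

(** The bound on the polynomial is available at radius 1/2, and the factors 1 + l u_i cost another
    2, so the estimate is made at radius 1/4. Homogeneity carries it to the torus at the price 4^m;
    the two uses of [poly_coef_le] account for the last factor 4. *)
Lemma torus_euler_le b (B : C) m z : (0 < m)%N ->
  (forall z, (forall i, `|z i| <= 2^-1) -> `|\sum_a b a * monom z (box_index a)| <= B) ->
  (forall i, `|z i| = 1) ->
  \sum_i `|hom_part (fun a => (a i)%:R * b a) m z| <= 4 ^+ m.+1 * (B - `|b [ffun=> ord0]|).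
Proof.
move=> m0 bB z1.
have scale d : hom_part d m z = 4 ^+ m * hom_part d m (fun i => 4^-1 * z i).
  rewrite mulr_sumr; apply: eq_bigr => a /eqP am.
  by rewrite monomM monom_cst am exprVn; field.
under eq_bigr do rewrite scale normrM (ger0_norm (exprn_ge0 _ _)) //.
rewrite -mulr_sumr exprSr -mulrA ler_pM2l ?exprn_gt0 //.
have -> : 4 * (B - `|b [ffun=> ord0]|) = 2 * (2 * (B - `|b [ffun=> ord0]|)) by ring.
apply: sum_norm_euler_le => [z' z'B|i]; first exact: hom_part_le.
by rewrite normrM z1 mulr1 ger0_norm.
Qed.

End Homogeneous.

(** * Tools for comparing moments *)

Lemma sum_leq_ord k c : (\sum_(x < k) (x <= c) = minn k c.+1)%N.
Proof.
elim: k => [|k IH]; first by rewrite big_ord0 min0n.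
by rewrite big_ord_recr /= IH; case: leqP; lia.
Qed.

(* Interpolates the second moment between the first and the fourth one:
   [f^2 <= t f + f^4 / t^2] with [t] twice [D] times the quadratic mean. *)
Lemma quadratic_mean_le (R : rcfType) (T : finType) (f : T -> R) (K D S : R) :
  (forall t, 0 <= f t) -> 0 < K -> 0 < D -> 0 <= S ->
  \sum_t f t ^+ 2 = K * S -> \sum_t f t ^+ 4 <= K * (D * S) ^+ 2 ->
  K * Num.sqrt S <= 3 * D * \sum_t f t.
Proof.
move=> f0 K0 D0; rewrite le_eqVlt => /orP[/eqP <- _ _|S0 m2 m4].
  by rewrite sqrtr0 mulr0 mulr_ge0 ?sumr_ge0 // mulr_ge0 // ltW.
set s := Num.sqrt S; have s0 : 0 < s by rewrite sqrtr_gt0.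
have sS : S = s ^+ 2 by rewrite sqr_sqrtr // ltW.
pose t := 2 * D * s; have t0 : 0 < t by rewrite !mulr_gt0.
have le_f i : f i ^+ 2 <= t * f i + f i ^+ 4 / t ^+ 2.
  have [fit|tfi] := leP (f i) t.
    rewrite (@le_trans _ _ (t * f i)) //; first by rewrite expr2 ler_wpM2r.
    by rewrite lerDl divr_ge0 ?exprn_ge0 // ltW.
  rewrite (@le_trans _ _ (f i ^+ 4 / t ^+ 2)) //; last by rewrite lerDr mulr_ge0 // ltW.
  rewrite ler_pdivlMr ?exprn_gt0 // -[4%N]/(2 + 2)%N exprD ler_pM ?exprn_ge0 ?(ltW t0) //.
  by rewrite lerXn2r ?nnegrE ?f0 ?(ltW t0) // ltW.
have : K * S <= t * (\sum_i f i) + (K * (D * S) ^+ 2) / t ^+ 2.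
  rewrite -m2 (le_trans (ler_sum _ (fun i _ => le_f i))) // big_split /= -mulr_sumr -mulr_suml.
  by rewrite lerD2l ler_wpM2r // invr_ge0 exprn_ge0 // ltW.
have -> : K * (D * S) ^+ 2 / t ^+ 2 = K * s ^+ 2 / 4.
  by rewrite sS /t; field; rewrite !gt_eqF.
rewrite sS => h; rewrite -(ler_pM2r s0).
have F0 : 0 <= \sum_i f i by apply: sumr_ge0.
rewrite /t in h; set F := \sum_i _ in h F0 *.
have : 0 <= D * s * F by rewrite !mulr_ge0 // ltW.
nra.
Qed.

(** * Second and fourth moments on grids of roots of unity, and a Khinchin type inequality *)

Section Grid.
Variables (R : realType) (n : nat).
Local Notation C := R[i].
Local Notation T N := {ffun 'I_n -> 'I_N.+1}.

Lemma normcE (x : C) : `|x| = (cmod x)%:C%C.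
Proof. by []. Qed.

Lemma cmod_ge0 (x : C) : 0 <= cmod x.
Proof. by case: x => a b; apply: sqrtr_ge0. Qed.

Definition grid N (w : C) (t : T N) : 'I_n -> C := fun i => w ^+ t i.

(** The sum factors into one-variable sums, and N + 1 points per coordinate separate the exponents
    0, ..., N. *)
Lemma grid_ortho N (w : C) (a a' : T N) : N.+1.-primitive_root w ->
  \sum_(t : T N) monom (grid w t) (box_index a) * (monom (grid w t) (box_index a'))^* =
  if a == a' then N.+1%:R ^+ n else 0.
Proof.
move=> wP.
transitivity (\sum_(t : T N) \prod_i (w ^+ (a i * t i) * (w ^+ (a' i * t i))^*)).
  apply: eq_bigr => t _; rewrite /monom rmorph_prod -big_split /=; apply: eq_bigr => i _.
  by rewrite !ffunE /grid -!exprM ![(t i * _)%N]mulnC.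
rewrite -(bigA_distr_bigA (fun i (x : 'I_N.+1) => w ^+ (a i * x) * (w ^+ (a' i * x))^*)).
under eq_bigr do rewrite sum_prim_root // !modn_small //.
case: eqP => [->|/eqP]; first by under eq_bigr do rewrite eqxx; rewrite prodr_const card_ord.
move=> aa'; have /existsP[i ai] : [exists i, a i != a' i].
  by apply: contraNT aa' => /existsPn h; apply/eqP/ffunP => i; have := h i; rewrite negbK => /eqP.
by apply/eqP/prodf_eq0; exists i => //; rewrite (ifN _ _ (ai : (a i : nat) != a' i)).
Qed.

Lemma norm_grid N (w : C) (t : T N) i : N.+1.-primitive_root w -> `|grid w t i| = 1.
Proof. by move=> wP; rewrite normrX (norm_prim_root wP) expr1n. Qed.

(** Cauchy-Schwarz against the constant 1, through |d_j| |d_k| <= (|d_j|^2 + |d_k|^2) / 2. *)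
Lemma norm_sum_sqr_le (J : finType) (P : pred J) (d : J -> C) :
  `|\sum_(j | P j) d j| ^+ 2 <= #|P|%:R * \sum_(j | P j) `|d j| ^+ 2.
Proof.
have h : `|\sum_(j | P j) d j| <= \sum_(j | P j) `|d j| := ler_norm_sum _ _ _.
rewrite (le_trans (y := (\sum_(j | P j) `|d j|) ^+ 2)) //.
  by rewrite lerXn2r ?nnegrE ?sumr_ge0.
have -> : #|P|%:R * \sum_(j | P j) `|d j| ^+ 2 =
    \sum_(j | P j) \sum_(k | P k) (`|d j| ^+ 2 + `|d k| ^+ 2) / 2.
  under [RHS]eq_bigr do rewrite -mulr_suml big_split sumr_const /=.
  rewrite -mulr_suml big_split /= sumrMnl sumr_const -mulr_natl; by field.
rewrite expr2 mulr_suml; apply: ler_sum => j _; rewrite mulr_sumr; apply: ler_sum => k _.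
rewrite -subr_ge0 (_ : _ - _ = (`|d j| - `|d k|) ^+ 2 / 2); last by field.
by rewrite divr_ge0 // real_exprn_even_ge0 // rpredB ?normr_real.
Qed.

Section TwoGrids.
Variable N : nat.
Local Notation N2 := (N + N)%N.

(** [inord] never takes its default value, since a i + a' i <= N + N. Products of two monomials need
    this larger box, hence grids with 2N + 1 points per coordinate. *)
Definition add_index (a a' : T N) : T N2 := [ffun i => inord (a i + a' i)].

Definition widen_index (a : T N) : T N2 := [ffun i => inord (a i)].

Lemma box_add_index a a' i : box_index (add_index a a') i = (a i + a' i)%N.
Proof.
rewrite !ffunE inordK // ltnS leq_add //; by rewrite -ltnS.
Qed.

Lemma box_widen_index a : box_index (widen_index a) = box_index a.
Proof.
by apply/ffunP => i; rewrite !ffunE inordK // ltnS (leq_trans _ (leq_addr _ _)) // -ltnS.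
Qed.

(** A pair is determined by its first entry, which lies coordinatewise below g. There are at most
    prod (g_i + 1) <= 2^(sum g_i) = 2^(2m) such entries. *)
Lemma add_index_fiber (m : nat) (g : T N2) :
  (#|[pred x : T N * T N | (mdeg (box_index x.1) == m) && (mdeg (box_index x.2) == m)
      && (add_index x.1 x.2 == g)]| <= 4 ^ m)%N.
Proof.
set P := [pred x | _].
have [->|/existsP[x0 /andP[/andP[/eqP x1 /eqP x2] /eqP x0g]]] := eqVneq #|P| 0; first by [].
have gm : (\sum_i g i = m + m)%N.
  rewrite -{1}x1 -{1}x2 /mdeg -big_split /=; apply: eq_bigr => i _.
  have := box_add_index x0.1 x0.2 i.
  by rewrite x0g !ffunE.
pose F i := [pred x : 'I_N.+1 | (x <= g i)%N].
apply: (@leq_trans #|family F|).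
  rewrite -(@card_in_imset _ _ (fun x => x.1) P) => [|[a a'] [c c']].
    apply: subset_leq_card; apply/fintype.subsetP => _ /imsetP[[a a'] /andP[_ /eqP ag] ->].
    apply/familyP => i; rewrite inE /=; have := box_add_index a a' i.
    by rewrite ag ffunE => ->; rewrite leq_addr.
  move=> /andP[_ /eqP /= ag] /andP[_ /eqP /= cg] /= ac; congr (_, _) => //; apply/ffunP => i.
  have := congr1 (fun g => box_index g i) (etrans ag (esym cg)).
  by rewrite /= !box_add_index ac => /addnI /val_inj.
rewrite card_family foldrE big_map big_enum /=.
apply: (@leq_trans (\prod_i 2 ^ g i)%N).
  apply: leq_prod => i _; rewrite -sum1_card big_mkcond /=.
  rewrite (eq_bigr (fun x : 'I_N.+1 => ((x <= g i)%N : nat))) => [|x _]; last by rewrite unfold_in; case: leq.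
  by rewrite sum_leq_ord (leq_trans (geq_minr _ _)) // ltn_expl.
by rewrite -expn_sum gm expnD -expnMn.
Qed.

Lemma monom_add_index (z : 'I_n -> C) a a' :
  monom z (box_index (add_index a a')) = monom z (box_index a) * monom z (box_index a').
Proof.
rewrite /monom -big_split /=; apply: eq_bigr => i _.
by rewrite box_add_index !ffunE exprD.
Qed.

Variable w : C.
Hypothesis wP : N2.+1.-primitive_root w.

Lemma hom_part_moment2 (c : T N -> C) m :
  \sum_(t : T N2) `|hom_part c m (grid w t)| ^+ 2 =
  N2.+1%:R ^+ n * \sum_(a | mdeg (box_index a) == m) `|c a| ^+ 2.
Proof.
pose c' a := if mdeg (box_index a) == m then c a else 0.
have -> : \sum_(a | mdeg (box_index a) == m) `|c a| ^+ 2 = \sum_a `|c' a| ^+ 2.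
  rewrite big_mkcond; apply: eq_bigr => a _.
  by rewrite /c'; case: ifP => //; rewrite normr0 expr0n.
rewrite -(@parseval C (T N) (T N2) (fun a t => monom (grid w t) (box_index a))) => [|a a'].
  apply: eq_bigr => t _; congr (`|_| ^+ 2); rewrite /hom_part big_mkcond.
  by apply: eq_bigr => a _; rewrite /c'; case: ifP => //; rewrite mul0r.
rewrite -!(box_widen_index a) -!(box_widen_index a') grid_ortho //.
rewrite (_ : (_ == _) = (a == a')) //; apply/eqP/eqP => [e|-> //].
apply/ffunP => i; apply: val_inj; have := congr1 (fun g => box_index g i) e.
by rewrite !box_widen_index !ffunE.
Qed.

(** The square of the homogeneous part has as coefficients sums over the fibres of [add_index].
    Parseval for this square and Cauchy-Schwarz on fibres of at most 4^m pairs give the factor 4^m =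
    (2^m)^2. *)
Lemma hom_part_moment4 (c : T N -> C) m :
  \sum_(t : T N2) `|hom_part c m (grid w t)| ^+ 4 <=
  N2.+1%:R ^+ n * (2 ^+ m * \sum_(a | mdeg (box_index a) == m) `|c a| ^+ 2) ^+ 2.
Proof.
pose P := [pred x : T N * T N | (mdeg (box_index x.1) == m) && (mdeg (box_index x.2) == m)].
pose d (x : T N * T N) := c x.1 * c x.2.
have sqE t : hom_part c m (grid w t) ^+ 2 =
    \sum_g (\sum_(x | P x && (add_index x.1 x.2 == g)) d x) * monom (grid w t) (box_index g).
  rewrite expr2 /hom_part big_distrlr /= pair_big /=.
  rewrite (partition_big (fun x => add_index x.1 x.2) xpredT) //=.
  apply: eq_bigr => g _; rewrite mulr_suml; apply: eq_bigr => -[a a'] /= /andP[_ /eqP <-].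
  by rewrite monom_add_index /d mulrACA.
have -> : \sum_(t : T N2) `|hom_part c m (grid w t)| ^+ 4 = \sum_(t : T N2) `|hom_part c m (grid w t) ^+ 2| ^+ 2.
  by apply: eq_bigr => t _; rewrite normrX -exprM.
under eq_bigr do rewrite sqE.
rewrite (parseval _ (fun g g' => grid_ortho g g' wP)) ler_pM2l ?exprn_gt0 ?ltr0n //.
rewrite exprMn -exprM mulnC exprM.
apply: (@le_trans _ _ (\sum_g 4 ^+ m * \sum_(x | P x && (add_index x.1 x.2 == g)) `|d x| ^+ 2)).
  apply: ler_sum => g _; apply: le_trans (norm_sum_sqr_le _ _) _.
  apply: ler_wpM2r; first by apply: sumr_ge0 => x _; rewrite exprn_ge0.
  by rewrite -natrX ler_nat add_index_fiber.
rewrite -mulr_sumr (_ : 2 ^+ 2 = 4); last by ring.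
rewrite ler_pM2l ?exprn_gt0 // le_eqVlt; apply/orP; left; apply/eqP.
rewrite -(partition_big (fun x => add_index x.1 x.2) xpredT) //=.
rewrite expr2 big_distrlr /= pair_big /=; apply: eq_bigr => x _.
by rewrite normrM exprMn.
Qed.

(** Interpolation between the moments above: [quadratic_mean_le] with D = 2^m. *)
Lemma hom_part_khinchin (c : T N -> C) m :
  (N2.+1%:R : R) ^+ n * Num.sqrt (\sum_(a | mdeg (box_index a) == m) cmod (c a) ^+ 2) <=
  3 * 2 ^+ m * \sum_(t : T N2) cmod (hom_part c m (grid w t)).
Proof.
have toC (I : finType) (Q : pred I) (f : I -> C) k :
    (\sum_(i | Q i) cmod (f i) ^+ k)%:C%C = \sum_(i | Q i) `|f i| ^+ k.
  rewrite rmorph_sum; apply: eq_bigr => i _; exact: (rmorphXn (real_complex R)).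
apply: quadratic_mean_le.
- by move=> t; apply: cmod_ge0.
- by rewrite exprn_gt0 ?ltr0n.
- by rewrite exprn_gt0.
- by apply: sumr_ge0 => a _; rewrite exprn_ge0 // cmod_ge0.
- apply: complexI; rewrite toC hom_part_moment2 -toC.
  by rewrite -(rmorph_nat (real_complex R)) -rmorphXn -rmorphM.
- rewrite -lecR toC; apply: le_trans (hom_part_moment4 _ _) _; rewrite -toC.
  rewrite -(rmorph_nat (real_complex R) N2.+1) -(rmorph_nat (real_complex R) 2).
  by rewrite -!rmorphXn -rmorphM -rmorphXn -rmorphM.
Qed.

End TwoGrids.
End Grid.

(** * The lower bound for polynomials *)

Section LowerBoundFinite.
Variables (R : realType) (n : nat).
Local Notation C := R[i].
Local Notation T N := {ffun 'I_n -> 'I_N.+1}.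

(** For each i, [hom_part_khinchin] replaces the l^2 norm by a grid average; the sum over i is then
    bounded at every grid point by [torus_euler_le]. The constant is 3 * 2^m * 4^(m+1). *)
Lemma sum_index_l2_le N (b : T N -> C) (B : R) m : (0 < m)%N ->
  (forall z, (forall i, `|z i| <= 2^-1) ->
    `|\sum_a b a * monom z (box_index a)| <= B%:C%C) ->
  \sum_i Num.sqrt (\sum_(a : T N | mdeg (box_index a) == m) ((a i)%:R * cmod (b a)) ^+ 2) <=
    12 * 8 ^+ m * (B - cmod (b [ffun=> ord0])).
Proof.
move=> m0 bB; have [w wP] := closed_prim_root_exists C (ltn0Sn (N + N)).
set K : R := (N + N).+1%:R ^+ n.
have K0 : 0 < K by rewrite exprn_gt0 ?ltr0n.
rewrite -(ler_pM2l K0) mulr_sumr.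
have le_i i : K * Num.sqrt (\sum_(a : T N | mdeg (box_index a) == m) ((a i)%:R * cmod (b a)) ^+ 2)
    <= 3 * 2 ^+ m * \sum_(t : T (N + N)%N)
       cmod (hom_part (fun a : T N => (a i)%:R * b a) m (grid w t)).
  rewrite (le_trans _ (hom_part_khinchin wP _ _)) // ler_wpM2l ?(ltW K0) //.
  rewrite ler_wsqrtr // ler_sum // => a _.
  rewrite /cmod ComplexField.Normc.normcM -!/(cmod _).
  rewrite (_ : cmod (a i)%:R = (a i)%:R) //.
  by apply: complexI; rewrite -normcE normr_nat rmorph_nat.
apply: le_trans (ler_sum _ (fun i _ => le_i i)) _.
rewrite -mulr_sumr exchange_big /=.
have -> : K * (12 * 8 ^+ m * (B - cmod (b [ffun=> ord0]))) =
    3 * 2 ^+ m * \sum_(t : T (N + N)%N) (4 ^+ m.+1 * (B - cmod (b [ffun=> ord0]))).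
  rewrite sumr_const card_ffun !card_ord -[X in _ = _ * X]mulr_natl natrX -/K exprS.
  rewrite (_ : 8 = 2 * 4) ?exprMn; first by ring.
  by ring.
rewrite ler_pM2l ?mulr_gt0 ?exprn_gt0 // ler_sum // => t _.
rewrite -lecR rmorph_sum /= !(rmorphM, rmorphB, rmorphXn) /= -normcE.
have := torus_euler_le m0 bB (fun i => norm_grid t i wP).
by rewrite (rmorph_nat _ 4).
Qed.

Lemma sum_exprn_le (x : R) N : 0 <= x < 1 -> \sum_(k < N) x ^+ k <= (1 - x)^-1.
Proof.
move=> /andP[x0 x1]; rewrite -[leRHS]mul1r ler_pdivlMr ?subr_gt0 // mulrC.
have := subrX1 x N; have := exprn_ge0 N x0; lra.
Qed.

(* [x] times the number of multi-indices of degree [m] involving [i], read off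
   from the generating function [x / (1 - x) ^ n]. *)
Lemma card_index_le N (x : R) m i : 0 <= x < 1 -> x <= (1 - x) ^+ n ->
  #|[pred a : T N | (mdeg (box_index a) == m) && (0 < a i)%N]|%:R * x ^+ m <= 1.
Proof.
move=> x01 xn; have /andP[x0 x1] := x01.
pose F (j : 'I_n) (k : 'I_N.+1) : R := if (j == i) && (k == ord0) then 0 else x ^+ k.
have F0 j k : 0 <= F j k by rewrite /F; case: ifP => // _; rewrite exprn_ge0.
apply: (@le_trans _ _ (\sum_(a : T N) \prod_j F j (a j))).
  rewrite -sum1_card natr_sum mulr_suml big_mkcond /=; apply: ler_sum => a _.
  case: ifP => [/andP[/eqP am ai]|_]; last exact: prodr_ge0.
  rewrite mul1r -am /mdeg -prodrXr le_eqVlt; apply/orP; left; apply/eqP.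
  apply: eq_bigr => j _; rewrite ffunE /F; case: ifP => // /andP[/eqP ji /eqP aj].
  by move: ai; rewrite -ji aj.
rewrite -(bigA_distr_bigA F).
apply: (@le_trans _ _ (\prod_(j < n) ((if j == i then x else 1) * (1 - x)^-1))).
  apply: ler_prod => j _; rewrite sumr_ge0 //= /F.
  case: (j == i) => /=; last by rewrite mul1r sum_exprn_le.
  rewrite big_ord_recl /= add0r.
  under eq_bigr do rewrite /= /bump /= add1n exprS.
  by rewrite -mulr_sumr ler_wpM2l ?sum_exprn_le.
rewrite big_split /= -big_mkcond big_pred1_eq prodr_const card_ord exprVn.
by rewrite ler_pdivrMr ?mul1r // exprn_gt0 // subr_gt0.
Qed.

(** For u <= t the summand 1 suffices; for u > t, (u / t)^p <= (u / t)^2 because p < 2. *)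
Lemma powR_le_quadratic (p u t k : R) : 1 < p < 2 -> 0 <= u -> 0 < t -> 0 <= k ->
  (u * k) `^ p <= (t * k) `^ p * (1 + u ^+ 2 / t ^+ 2).
Proof.
move=> /andP[p1 p2] u0 t0 k0.
have v0 : 0 <= u / t by rewrite divr_ge0 // ltW.
have -> : u * k = u / t * (t * k) by field; rewrite gt_eqF.
rewrite (powRM _ v0 (mulr_ge0 (ltW t0) k0)) mulrC ler_wpM2l ?powR_ge0 // -expr_div_n.
have [v1|v1] := leP (u / t) 1.
  apply: (@le_trans _ _ (1 `^ p)); last by rewrite powR1 lerDl exprn_ge0.
  by rewrite ge0_ler_powR ?nnegrE // ltW // (lt_trans _ p1).
rewrite (@le_trans _ _ ((u / t) `^ 2)) //; first by rewrite ler_powR ?ltW.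
by rewrite (powR_mulrn 2) // lerDr.
Qed.

(** A form of Hoelder's inequality, obtained from [powR_le_quadratic] at the threshold s y^m, with s
    the l^2 norm of u and y the square root of x. The terms below the threshold are controlled by
    the cardinality, those above it by s. *)
Lemma psum_card_le (I : finType) (P : pred I) (p x : R) (u : I -> R) m :
  1 < p < 2 -> 0 < x -> #|P|%:R * x ^+ m <= 1 -> (forall a, 0 <= u a) ->
  \sum_(a | P a) (u a * (x `^ ((2 - p) / (2 * p))) ^+ m) `^ p <=
  2 * Num.sqrt (\sum_(a | P a) u a ^+ 2) `^ p.
Proof.
move=> p12 x0 cardP u0; have /andP[p1 p2] := p12.
set S := \sum_(a | P a) u a ^+ 2.
set th := x `^ _; have p0 : 0 < p by lra.
have S0 : 0 <= S by rewrite sumr_ge0 // => a _; rewrite exprn_ge0.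
move: (S0); rewrite le_eqVlt => /orP[/eqP S_0|Spos].
  rewrite big1 ?mulr_ge0 ?powR_ge0 // => a Pa.
  have := psumr_eq0P (fun a (_ : P a) => exprn_ge0 2 (u0 a)) (esym S_0) Pa.
  by move=> /eqP; rewrite sqrf_eq0 => /eqP ->; rewrite mul0r powR0 // gt_eqF.
set s := Num.sqrt S; have s0 : 0 < s by rewrite sqrtr_gt0.
have sS : s ^+ 2 = S by rewrite sqr_sqrtr.
set y := Num.sqrt x; have y0 : 0 < y by rewrite sqrtr_gt0.
have yx : y ^+ 2 = x by rewrite sqr_sqrtr // ltW.
have th0 : 0 < th by rewrite powR_gt0.
(* This identity dictates the exponent (2 - p) / (2p): p / 2 + (2 - p) / 2 = 1. *)
have thy : (y * th) `^ p = x.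
  rewrite powRM ?(ltW y0) ?(ltW th0) // /y -powR12_sqrt ?(ltW x0) // /th -!powRrM -powRD.
    by rewrite (_ : _ + _ = 1) ?powRr1 ?(ltW x0) //; field; rewrite gt_eqF.
  by rewrite (gt_eqF x0) implybT.
have bnd a : (u a * th ^+ m) `^ p <= s `^ p * (x ^+ m + u a ^+ 2 / S).
  have := powR_le_quadratic p12 (u0 a) (mulr_gt0 s0 (exprn_gt0 m y0)) (exprn_ge0 m (ltW th0)).
  move=> /le_trans; apply.
  rewrite -mulrA -exprMn powRM ?(ltW s0) ?exprn_ge0 ?mulr_ge0 ?(ltW y0) ?(ltW th0) //.
  have -> : ((y * th) ^+ m) `^ p = x ^+ m.
    have yth0 : 0 <= y * th by rewrite mulr_ge0 ?ltW.
    by rewrite -(powR_mulrn m yth0) -powRrM (mulrC m%:R) powRrM thy powR_mulrn ?ltW.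
  rewrite -mulrA ler_wpM2l ?powR_ge0 // exprMn -exprM mulnC exprM yx sS.
  rewrite le_eqVlt; apply/orP; left; apply/eqP; field.
  by rewrite !gt_eqF ?exprn_gt0.
apply: le_trans (ler_sum _ (fun a _ => bnd a)) _.
rewrite -mulr_sumr mulrC ler_wpM2r ?powR_ge0 // big_split /= -mulr_suml -/S divff ?gt_eqF //.
rewrite sumr_const -[x ^+ m *+ _]mulr_natl.
by apply: le_trans (lerD cardP (lexx 1)) _; lra.
Qed.

Lemma powR_le_id (p y : R) : 1 < p -> 0 <= y <= 1 -> y `^ p <= y.
Proof.
move=> p1 /andP[]; rewrite le_eqVlt => /orP[/eqP <- _|y0 y1].
  by rewrite powR0 // gt_eqF // (lt_trans _ p1).
by rewrite -[leRHS]powRr1 ?(ltW y0) // ger_powR ?y0 // ltW.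
Qed.

(** The indices of degree m are grouped by a variable i that they involve. Each group is small by
    [card_index_le], and as a i >= 1 on it, its l^2 norm is at most the weighted norm [s i], whose
    sum over i is known. *)
Lemma hom_psum_le N (b : T N -> C) (p x B kap : R) m :
  1 < p < 2 -> 0 < x < 1 -> x <= (1 - x) ^+ n -> 0 < kap -> 16 * kap <= 64^-1 -> B <= 2 -> (0 < m)%N ->
  (forall z, (forall i, `|z i| <= 2^-1) ->
    `|\sum_a b a * monom z (box_index a)| <= B%:C%C) ->
  \sum_(a : T N | mdeg (box_index a) == m)
     (cmod (b a) * (kap * x `^ ((2 - p) / (2 * p))) ^+ m) `^ p <=
  (B - cmod (b [ffun=> ord0])) / 2 ^+ m.
Proof.
move=> p12 /andP[x0 x1] xn kap0 kap64 B2 m0 bB; have /andP[p1 p2] := p12.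
set th := x `^ _; have th0 : 0 <= th := powR_ge0 _ _.
pose B' := B - cmod (b [ffun=> ord0]); rewrite -/B'; pose k : R := kap ^+ m; have k0 : 0 < k by rewrite exprn_gt0.
pose u (a : T N) : R := cmod (b a) * k.
have u0 a : 0 <= u a by rewrite mulr_ge0 ?cmod_ge0 // ltW.
pose s i := Num.sqrt (\sum_(a : T N | mdeg (box_index a) == m) ((a i)%:R * cmod (b a)) ^+ 2).
have s_sum : \sum_i s i <= 12 * 8 ^+ m * B' by apply: sum_index_l2_le.
have s0 i : 0 <= s i := sqrtr_ge0 _.
have B'0 : 0 <= B'.
  have := le_trans (sumr_ge0 _ (fun i _ => s0 i)) s_sum.
  by rewrite pmulr_rge0 // mulr_gt0 ?exprn_gt0.
have B'2 : B' <= 2 by rewrite /B'; have := cmod_ge0 (b [ffun=> ord0]); lra.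
(* The condition on [kap] is made for this: 8 kap = (16 kap) / 2 and 12 / 64 <= 1 / 4. *)
have small : 12 * 8 ^+ m * k <= 4^-1 * (2 ^+ m)^-1.
  have -> : 12 * 8 ^+ m * k = 12 * (16 * kap) ^+ m * (2 ^+ m)^-1.
    by rewrite -!mulrA /k -!exprVn -!exprMn; congr (_ * _ ^+ _); field.
  have kap_m : (16 * kap) ^+ m <= 64^-1 ^+ m by rewrite lerXn2r // nnegrE ?mulr_ge0 ?(ltW kap0).
  have le64 : 64^-1 ^+ m <= 64^-1 :> R.
    by case: (m) m0 => // q _; rewrite exprS ler_piMr // exprn_ile1 // invf_le1 ?ler1n.
  rewrite ler_wpM2r ?invr_ge0 ?exprn_ge0 //; lra.
pose A := k * (12 * 8 ^+ m * B').
have A1 : A <= (B' / 2 ^+ m) / 4.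
  have -> : A = B' * (12 * 8 ^+ m * k) by rewrite /A; ring.
  have -> : B' / 2 ^+ m / 4 = B' * (4^-1 * (2 ^+ m)^-1) by rewrite mulrAC -mulrA.
  by rewrite ler_wpM2l.
have m2 : (2 ^+ m)^-1 <= 1 :> R by rewrite invf_le1 ?exprn_gt0 // exprn_ege1 ?ler1n.
have A2 : A <= 1.
  apply: le_trans A1 _; have : B' * (2 ^+ m)^-1 <= B' * 1 by rewrite ler_wpM2l.
  by lra.
have ks i : 0 <= k * s i <= 1.
  rewrite mulr_ge0 ?(ltW k0) //=; apply: le_trans A2; rewrite /A ler_wpM2l ?(ltW k0) //.
  by apply: le_trans s_sum; rewrite (bigD1 i) //= lerDl sumr_ge0.
have cover : \sum_(a : T N | mdeg (box_index a) == m) (u a * th ^+ m) `^ p <=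
   \sum_i \sum_(a : T N | (mdeg (box_index a) == m) && (0 < a i)%N) (u a * th ^+ m) `^ p.
  rewrite (exchange_big_dep (fun a : T N => mdeg (box_index a) == m)) /=; last by move=> i a _ /andP[].
  apply: ler_sum => a /eqP am.
  have [i ai] : exists i, (0 < a i)%N.
    apply/existsP; apply: contraLR m0 => /existsPn h; rewrite -am lt0n negbK sum_nat_eq0.
    by apply/forallP => i; rewrite ffunE /= -leqn0 leqNgt h.
  rewrite (bigD1 i) /=; last by rewrite am eqxx ai.
  by rewrite lerDl sumr_ge0 // => j _; rewrite powR_ge0.
have -> : \sum_(a : T N | mdeg (box_index a) == m) (cmod (b a) * (kap * th) ^+ m) `^ p =
    \sum_(a : T N | mdeg (box_index a) == m) (u a * th ^+ m) `^ p.
  by apply: eq_bigr => a _; rewrite exprMn mulrA.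
apply: le_trans cover _.
apply: (@le_trans _ _ (\sum_i 2 * (k * s i))).
  apply: ler_sum => i _.
  have x01 : 0 <= x < 1 by rewrite ltW.
  apply: le_trans (psum_card_le p12 x0 (card_index_le N m i x01 xn) u0) _.
  rewrite ler_wpM2l //; apply: le_trans _ (powR_le_id p1 (ks i)).
  rewrite ge0_ler_powR ?nnegrE ?sqrtr_ge0 ?(andP (ks i)).1 // ?(ltW (lt_trans _ p1)) //.
  rewrite -[k](ger0_norm (ltW k0)) -sqrtr_sqr -sqrtrM ?sqr_ge0 // ler_wsqrtr //.
  rewrite mulr_sumr big_mkcondr /=; apply: ler_sum => a _.
  case: ifP => [ai|_]; last by rewrite mulr_ge0 ?sqr_ge0.
  rewrite -exprMn lerXn2r ?nnegrE ?u0 ?mulr_ge0 ?cmod_ge0 ?(ltW k0) //.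
  by rewrite /u mulrC ler_wpM2l ?(ltW k0) // ler_peMl ?cmod_ge0 // ler1n.
rewrite -!mulr_sumr; apply: (@le_trans _ _ (2 * A)).
  by rewrite ler_wpM2l // ler_wpM2l // ltW.
have : 0 <= B' / 2 ^+ m by rewrite divr_ge0 // exprn_ge0.
lra.
Qed.

(** Degree 0 contributes at most |b_0| and degree m at most (B - |b_0|) / 2^m; the geometric series
    adds up to B. *)
Lemma box_psum_le N (b : T N -> C) (p x B kap : R) :
  1 < p < 2 -> 0 < x < 1 -> x <= (1 - x) ^+ n -> 0 < kap -> 16 * kap <= 64^-1 -> B <= 2 ->
  cmod (b [ffun=> ord0]) <= 1 ->
  (forall z, (forall i, `|z i| <= 2^-1) ->
    `|\sum_a b a * monom z (box_index a)| <= B%:C%C) ->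
  \sum_(a : T N) (cmod (b a) * (kap * x `^ ((2 - p) / (2 * p))) ^+ mdeg (box_index a)) `^ p <= B.
Proof.
move=> p12 x01 xn kap0 kap64 B2 b1 bB; have /andP[p1 p2] := p12.
set r := kap * _; pose f (a : T N) := (cmod (b a) * r ^+ mdeg (box_index a)) `^ p.
have hom m : \sum_(a : T N | mdeg (box_index a) == m.+1) f a <=
    (B - cmod (b [ffun=> ord0])) / 2 ^+ m.+1.
  apply: le_trans (hom_psum_le p12 x01 xn kap0 kap64 B2 (ltn0Sn m) bB).
  by rewrite le_eqVlt; apply/orP; left; apply/eqP/eq_bigr => a /eqP am; rewrite /f am.
have b0B : 0 <= B - cmod (b [ffun=> ord0]).
  have : 0 <= (B - cmod (b [ffun=> ord0])) / 2 ^+ 1.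
    by apply: le_trans (hom 0); apply: sumr_ge0 => a _; rewrite powR_ge0.
  by rewrite pmulr_lge0 ?invr_gt0 ?exprn_gt0.
pose L := (\max_(a : T N) mdeg (box_index a))%N.
have LP (a : T N) : (mdeg (box_index a) < L.+1)%N by rewrite ltnS (leq_bigmax a).
rewrite -/(f _) (partition_big (fun a : T N => Ordinal (LP a)) xpredT) //=.
rewrite big_ord_recl /=; set S0 := \sum_(a | _) _.
have S0_le : S0 <= cmod (b [ffun=> ord0]).
  rewrite /S0 (big_pred1 [ffun=> ord0]) => [|a]; last by rewrite -val_eqE /= mdeg_box_eq0.
  rewrite (eqP (_ : mdeg _ == 0)) ?mdeg_box_eq0 // mulr1.
  by rewrite powR_le_id // cmod_ge0.
rewrite -(subrKC (cmod (b [ffun=> ord0])) B); apply: lerD => //.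
apply: (@le_trans _ _ (\sum_(m < L) (B - cmod (b [ffun=> ord0])) / 2 ^+ m.+1)).
  by apply: ler_sum => m _; apply: hom.
rewrite -mulr_sumr -[leRHS]mulr1 ler_wpM2l //.
have -> : \sum_(m < L) (2 ^+ m.+1)^-1 = 2^-1 * \sum_(m < L) 2^-1 ^+ m :> R.
  by rewrite mulr_sumr; apply: eq_bigr => m _; rewrite exprS invfM exprVn.
have half : 0 <= 2^-1 :> R by []. have half1 : 2^-1 < 1 :> R by rewrite invf_lt1 ?ltr1n.
have := @sum_exprn_le 2^-1 L; rewrite half half1 => /(_ isT).
have -> : (1 - 2^-1)^-1 = 2 :> R by rewrite (_ : 1 - 2^-1 = 2^-1) ?invrK //; lra.
lra.
Qed.

End LowerBoundFinite.

(** * From power series to partial sums over boxes *)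

Section BoxSums.
Variables (R : realType) (n : nat).
Local Notation C := R[i].
Local Notation T N := {ffun 'I_n -> 'I_N.+1}.
Local Open Scope classical_set_scope.

(** Boxes of different sides are put in one type, so that they can be compared. *)
Definition boxes N : seq (multi_index n) := [seq box_index a | a <- enum {: T N}].

Lemma box_index_inj N : injective (@box_index n N).
Proof.
move=> a a' e; apply/ffunP => i; apply: val_inj.
by have := congr1 (fun g : multi_index n => g i) e; rewrite !ffunE.
Qed.

Lemma boxes_uniq N : uniq (boxes N).
Proof. by rewrite map_inj_uniq ?enum_uniq //; apply: box_index_inj. Qed.

Lemma mem_boxes N (a : multi_index n) : (a \in boxes N) = [forall i, (a i <= N)%N].
Proof.
apply/mapP/forallP => [[b _ ->] i|aN]; first by rewrite ffunE -ltnS.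
exists [ffun i => inord (a i)]; first by rewrite mem_enum.
by apply/ffunP => i; rewrite !ffunE inordK // ltnS aN.
Qed.

Lemma sum_boxes (V : nmodType) N (g : multi_index n -> V) :
  \sum_(a <- boxes N) g a = \sum_(a : T N) g (box_index a).
Proof. by rewrite big_map big_enum. Qed.

Lemma sum_boxes_le N M (V : nmodType) (g : multi_index n -> V) : (N <= M)%N ->
  \sum_(a <- boxes M) g a = \sum_(a <- boxes N) g a + \sum_(a <- boxes M | a \notin boxes N) g a.
Proof.
move=> NM; rewrite (bigID (mem (boxes N))) /=; congr (_ + _).
rewrite -big_filter; apply: perm_big; apply: uniq_perm; rewrite ?filter_uniq ?boxes_uniq // => a.
rewrite mem_filter !mem_boxes; case: forallP => //= aN.
by apply/forallP => i; apply: leq_trans (aN i) NM.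
Qed.

Lemma finite_set_boxes (X : set (multi_index n)) : finite_set X ->
  exists N, forall M, (N <= M)%N -> X `<=` [set` boxes M].
Proof.
move=> /finite_seqP[s ->]; exists (\max_(a <- s) \max_i a i)%N => M sM a /= sa.
rewrite mem_boxes; apply/forallP => i; apply: leq_trans sM.
by apply: leq_trans (leq_bigmax_seq _ sa isT); apply: leq_bigmax.
Qed.

Lemma boxes_le_esum (g : multi_index n -> R) N : (forall a, 0 <= g a) ->
  ((\sum_(a <- boxes N) g a)%:E <= \esum_(a in [set: multi_index n]) (g a)%:E)%E.
Proof.
move=> g0; apply: esum_ge; exists [set` boxes N]; first by split => //; exact: finite_seq.
by rewrite -fsbig_seq ?boxes_uniq // sumEFin.
Qed.

Lemma finite_sum_le_boxes (g : multi_index n -> R) (X : set (multi_index n)) :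
  (forall a, 0 <= g a) -> finite_set X ->
  exists N, forall M, (N <= M)%N ->
    (\sum_(a \in X) (g a)%:E <= (\sum_(a <- boxes M) g a)%:E)%E.
Proof.
move=> g0 finX; have [N NP] := finite_set_boxes finX; exists N => M /NP XM.
rewrite -sumEFin [leRHS]fsbig_seq ?boxes_uniq //.
apply: lee_fsum_nneg_subset => // [a|a _]; last by rewrite lee_fin g0.
by rewrite !inE => /XM.
Qed.

Lemma cmodM (x y : C) : cmod (x * y) = cmod x * cmod y.
Proof. exact: ComplexField.Normc.normcM. Qed.

Lemma cmod_prod (I : finType) (f : I -> C) : cmod (\prod_i f i) = \prod_i cmod (f i).
Proof. by apply: complexI; rewrite -normcE normr_prod rmorph_prod. Qed.

Lemma cmodX (x : C) k : cmod (x ^+ k) = cmod x ^+ k.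
Proof. by apply: complexI; rewrite -normcE normrX rmorphXn. Qed.

Lemma cmod_ger0 (x : R) : 0 <= x -> cmod x%:C%C = x.
Proof. by move=> x0; apply: complexI; rewrite -normcE ger0_norm // lecR. Qed.

Lemma cmod_monom_le (z : 'I_n -> C) (r : R) a : (forall i, cmod (z i) <= r) ->
  cmod (monom z a) <= r ^+ mdeg a.
Proof.
move=> zr; rewrite /monom cmod_prod /mdeg -prodrXr; apply: ler_prod => i _.
rewrite cmodX exprn_ge0 ?cmod_ge0 //= lerXn2r ?nnegrE ?cmod_ge0 //.
exact: le_trans (cmod_ge0 _) (zr i).
Qed.

(** Absolute convergence at the point (1/2, ..., 1/2) makes the tail outside a large box at most e /
    2, uniformly for |z_i| <= 1/2. *)
Lemma holo_box_le (c : multi_index n -> C) (e : R) N0 : holo_unit_ball c -> 0 < e ->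
  exists2 N, (N0 <= N)%N & forall z, (forall i, `|z i| <= 2^-1) ->
    `|\sum_(a : T N) c (box_index a) * monom z (box_index a)| <= (1 + e)%:C%C.
Proof.
move=> [summable bounded] e0.
pose half : 'I_n -> C := fun=> 2^-1.
have cmod_half : cmod (2^-1 : C) = 2^-1.
  by apply: complexI; rewrite -normcE normfV normr_nat fmorphV rmorph_nat.
have half1 : (2^-1 : R) < 1 by rewrite invf_lt1 ?ltr1n.
have in_half : in_polydisk 1 half by move=> i; rewrite cmod_half.
pose g a := cmod (c a * monom half a).
have g0 a : 0 <= g a := cmod_ge0 _.
set S := (\esum_(a in [set: multi_index n]) (g a)%:E)%E.
have S0 : (0 <= S)%E by apply: esum_ge0 => a _; rewrite lee_fin.
have Sfin : S \is a fin_num by rewrite ge0_fin_numE // summable.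
have : (S - (e / 2)%:E < S)%E.
  by rewrite -(fineK Sfin) -EFinB lte_fin ltrBlDr ltrDl divr_gt0.
move=> /ereal_sup_gt[_ [X [finX _] <-] SX].
have [N1 N1P] := finite_sum_le_boxes g0 finX.
pose N := maxn N0 N1; exists N; first exact: leq_maxl.
have tail M : (N <= M)%N -> \sum_(a <- boxes M | a \notin boxes N) g a <= e / 2.
  move=> NM; have := sum_boxes_le g NM.
  have := lt_le_trans SX (N1P N (leq_maxr _ _)); have := boxes_le_esum M g0.
  by rewrite -/S -(fineK Sfin) -EFinB lte_fin lee_fin; lra.
move=> z zB; have zB' i : cmod (z i) <= 2^-1.
  by rewrite -lecR -normcE fmorphV rmorph_nat.
have zg a : `|c a * monom z a| <= (g a)%:C%C.
  rewrite normcE lecR /g !cmodM ler_wpM2l ?cmod_ge0 //.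
  by rewrite [leRHS](_ : _ = 2^-1 ^+ mdeg a) ?cmod_monom_le // /half monom_cst cmodX cmod_half.
have [l [cvl l1]] : exists l : C^o, (box_psum c z k : C^o) @[k --> \oo] --> l /\ cmod l <= 1.
  by apply: bounded => i; apply: le_lt_trans (zB' i) half1.
have e2C : 0 < (e / 2)%:C%C :> C by rewrite ltcR divr_gt0.
have /cvgrPdist_lt/(_ _ e2C)[K _ KP] := cvl.
pose M := maxn N K; have := KP M (leq_maxr _ _); rewrite /= => lM.
have psumE k : box_psum c z k = \sum_(a <- boxes k) c a * monom z a by rewrite sum_boxes.
rewrite -(sum_boxes N (fun a => c a * monom z a)).
set D := \sum_(a <- boxes M | a \notin boxes N) c a * monom z a.
(* The limit is at most 1 in modulus; M, which depends on z, makes the middle term small, and [D] is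
   part of the uniform tail. *)
have -> : \sum_(a <- boxes N) c a * monom z a = l - (l - box_psum c z M) - D.
  by rewrite psumE (sum_boxes_le _ (leq_maxl N K)) -/D; ring.
have D_le : `|D| <= (e / 2)%:C%C.
  apply: le_trans (ler_norm_sum _ _ _) _; apply: le_trans (ler_sum _ (fun a _ => zg a)) _.
  by rewrite -rmorph_sum lecR tail // leq_maxl.
apply: le_trans (ler_normB _ _) _.
have -> : (1 + e)%:C%C = 1 + (e / 2)%:C%C + (e / 2)%:C%C :> C.
  by apply/eqP; rewrite eq_complex /= !addr0 eqxx andbT; apply/eqP; field.
apply: lerD => //; apply: le_trans (ler_normB _ _) _; apply: lerD; last exact: ltW.
by rewrite normcE -[1]/(1%:C)%C lecR.
Qed.

End BoxSums.

(** * The lower bound for the Bohr radius *)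

Section LowerBound.
Variables (R : realType).
Local Notation C := R[i].
Local Open Scope classical_set_scope.

Lemma holo_coef0_le1 n (c : multi_index n -> C) : holo_unit_ball c -> cmod (c [ffun=> 0%N]) <= 1.
Proof.
move=> hc; apply/ler_addgt0Pr => e e0; have [N _ NP] := holo_box_le 0 hc e0.
have zB (i : 'I_n) : `|0 : C| <= 2^-1 by rewrite normr0 invr_ge0.
have := NP (fun=> 0) zB; rewrite (bigD1 [ffun=> ord0]) //= big1 => [|a a0]; last first.
  have : mdeg (box_index a) != 0 by rewrite mdeg_box_eq0.
  by move=> am; rewrite monom_cst expr0n (negPf am) mulr0.
have b0 : box_index [ffun=> ord0 : 'I_N.+1] = [ffun=> 0%N] :> multi_index n.
  by apply/ffunP => i; rewrite !ffunE.
have m0 : mdeg ([ffun=> 0%N] : multi_index n) = 0%N by rewrite /mdeg big1 // => i _; rewrite ffunE.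
by rewrite b0 monom_cst m0 mulr1 addr0 normcE lecR.
Qed.

(** The majorant is a supremum of finite sums, and each of them is dominated by the sum over a box
    whose polynomial is at most 1 + e' at radius 1/2. *)
Lemma bohr_radius_ge n (p x kap : R) :
  1 < p < 2 -> 0 < x < 1 -> x <= (1 - x) ^+ n -> 0 < kap -> 16 * kap <= 64^-1 ->
  ((kap * x `^ ((2 - p) / (2 * p)))%:E <= bohr_radius n p)%E.
Proof.
move=> p12 x01 xn kap0 kap64; set r := kap * _.
have r0 : 0 <= r by rewrite mulr_ge0 ?powR_ge0 // ltW.
have p0 : 0 <= p by have /andP[p1 _] := p12; lra.
apply: le_ereal_inf_tmp => _ [c hc <-]; apply: ereal_sup_ubound; exists r => //; split=> // z zr.
pose g a := cmod (c a * monom z a) `^ p.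
have g0 a : 0 <= g a := powR_ge0 _ _.
apply: ge_ereal_sup => _ [X [finX _] <-]; rewrite -/(g _).
have [N0 N0P] := finite_sum_le_boxes g0 finX.
apply/lee_addgt0Pr => e e0.
(* The minimum keeps B = 1 + e' at most 2, as [box_psum_le] requires. *)
pose e' := Num.min e 1.
have e'0 : 0 < e' by rewrite lt_min e0 ltr01.
have [N NN0 NP] := holo_box_le N0 hc e'0.
apply: le_trans (N0P N NN0) _; rewrite -EFinD lee_fin.
apply: (@le_trans _ _ (1 + e')); last by rewrite lerD2l ge_min lexx.
rewrite sum_boxes.
apply: le_trans (box_psum_le (b := fun a => c (box_index a)) p12 x01 xn kap0 kap64 _ _ NP).
- apply: ler_sum => a _; rewrite ge0_ler_powR ?nnegrE ?mulr_ge0 ?exprn_ge0 ?cmod_ge0 //.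
  by rewrite cmodM ler_wpM2l ?cmod_ge0 // cmod_monom_le // => i; apply: ltW.
- have : e' <= 1 by rewrite ge_min lexx orbT.
  lra.
- rewrite (_ : box_index _ = [ffun=> 0%N]) ?holo_coef0_le1 //.
  by apply/ffunP => i; rewrite !ffunE.
Qed.

(** With L = log n: since x <= 1/4, 1 - x >= exp(-2x), so (1 - x)^n >= exp(-L/2). The inequality x
    <= exp(-L/2) amounts to L <= 4 exp(L/2). *)
Lemma ln_div_bounds n : (1 < n)%N -> let x : R := ln n%:R / n%:R / 4 in
  0 < x < 1 /\ x <= (1 - x) ^+ n.
Proof.
move=> n1 x; have nR : 1 < n%:R :> R by rewrite ltr1n.
have n0 : 0 < n%:R :> R by apply: lt_trans nR.
have L0 : 0 < ln n%:R :> R by rewrite ln_gt0.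
have x0 : 0 < x by rewrite !divr_gt0.
have Ln : ln n%:R <= n%:R :> R.
  by have := expR_ge1Dx (ln n%:R : R); rewrite lnK ?posrE //; lra.
have x4 : x <= 4^-1.
  by rewrite /x -[leRHS]mul1r ler_pM2r ?invr_gt0 // ler_pdivrMr // mul1r.
split; first by rewrite x0 /=; apply: le_lt_trans x4 _; rewrite invf_lt1 ?ltr1n.
have x12 : 0 < 1 - x by lra.
have exp_le : expR (- (2 * x)) <= 1 - x.
  rewrite expRN -[leLHS]mul1r ler_pdivrMr ?expR_gt0 //.
  apply: (@le_trans _ _ ((1 - x) * (1 + 2 * x))); first by nra.
  by rewrite ler_wpM2l ?(ltW x12) // expR_ge1Dx.
apply: (@le_trans _ _ (expR (- (2 * x)) ^+ n)); last first.
  by rewrite lerXn2r ?nnegrE ?expR_ge0 ?(ltW x12).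
rewrite -expRM_natl.
set L := ln n%:R in x x0 L0 Ln x4 x12 exp_le *.
have nE : n%:R = expR L :> R by rewrite lnK.
have -> : n%:R * - (2 * x) = - (L / 2) by rewrite /x; field; rewrite gt_eqF.
have xE : x * (4 * expR (L / 2) ^+ 2) = L.
  rewrite expr2 -expRD -splitr -nE /x; field; by rewrite gt_eqF.
have := expR_ge1Dx (L / 2); have E0 := expR_gt0 (L / 2); move=> EL.
rewrite expRN -[leRHS]mul1r ler_pdivlMr //.
set E := expR _ in xE E0 EL *.
rewrite -(@ler_pM2r _ (4 * E)) ?mulr_gt0 // (_ : x * E * (4 * E) = L) -?xE; last by ring.
by rewrite xE; lra.
Qed.

End LowerBound.

(** * Unimodular coefficients with a small sup norm *)

Section ChainPolynomial.
Variables (C : numClosedFieldType) (k : nat).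
Hypothesis k0 : (0 < k)%N.
Local Notation word m := {ffun 'I_m -> 'I_k}.

Definition cons_word m (x : 'I_k * word m) : word m.+1 := [ffun j => oapp x.2 x.1 (unlift ord0 j)].

Definition tail_word m (w : word m.+1) : word m := [ffun j => w (lift ord0 j)].

Lemma cons_word0 m t (w : word m) : cons_word (t, w) ord0 = t.
Proof. by rewrite ffunE unlift_none. Qed.

Lemma cons_word_lift m t (w : word m) j : cons_word (t, w) (lift ord0 j) = w j.
Proof. by rewrite ffunE liftK. Qed.

Lemma tail_cons_word m t (w : word m) : tail_word (cons_word (t, w)) = w.
Proof. by apply/ffunP => j; rewrite ffunE cons_word_lift. Qed.

Lemma sum_word_recl m (F : word m.+1 -> C) :
  \sum_w F w = \sum_t \sum_(w : word m) F (cons_word (t, w)).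
Proof.
rewrite pair_big /= (reindex (@cons_word m)) /=; first by apply: eq_bigr => -[].
exists (fun w : word m.+1 => (w ord0, tail_word w)) => [[t w] _|w _].
  by rewrite cons_word0 tail_cons_word.
apply/ffunP => j; case: (unliftP ord0 j) => [i|] ->; last by rewrite cons_word0.
by rewrite cons_word_lift ffunE.
Qed.

(* The chain [\sum_w \prod_j omega^(w_j w_(j+1)) y_j (w_j)], a product of diagonal
   contractions and of Fourier matrices of norm [sqrt k]. *)
Lemma chain_family m : exists phi : 'I_k -> word m -> C,
  (forall s w, `|phi s w| = 1) /\
  forall y : 'I_m -> 'I_k -> C, (forall j t, `|y j t| <= 1) ->
    \sum_s `|\sum_w phi s w * \prod_j y j (w j)| ^+ 2 <= k%:R ^+ m.+1.
Proof.
have [omega omegaP] := closed_prim_root_exists C k0.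
elim: m => [|m [phi [phi1 phiP]]].
  exists (fun _ _ => 1); split=> [s w|y _]; first exact: normr1.
  rewrite (eq_bigr (fun=> 1)) ?sumr_const ?card_ord ?expr1 // => s _.
  under eq_bigr do rewrite big_ord0 mulr1.
  by rewrite sumr_const card_ffun !card_ord expn0 normr1 expr1n.
(* The index s acts as a letter in front of the word: each new letter brings one Fourier matrix, and
   Parseval one factor k. *)
exists (fun (s : 'I_k) (w : word m.+1) => omega ^+ (w ord0 * s) * phi (w ord0) (tail_word w)).
split=> [s w|y y1]; first by rewrite normrM phi1 normrX (norm_prim_root omegaP) expr1n mulr1.
pose G t := \sum_w phi t w * \prod_j y (lift ord0 j) (w j).
have stepE (s : 'I_k) : \sum_(w : word m.+1)
    omega ^+ (w ord0 * s) * phi (w ord0) (tail_word w) * \prod_j y j (w j) =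
    \sum_t (y ord0 t * G t) * omega ^+ (t * s).
  rewrite sum_word_recl; apply: eq_bigr => t _; rewrite mulrAC mulr_sumr; apply: eq_bigr => w _.
  rewrite big_ord_recl cons_word0 tail_cons_word.
  have -> : \prod_(j < m) y (lift ord0 j) (cons_word (t, w) (lift ord0 j)) =
      \prod_(j < m) y (lift ord0 j) (w j).
    by apply: eq_bigr => j _; rewrite cons_word_lift.
  by ring.
under eq_bigr do rewrite stepE.
rewrite (@parseval _ _ _ (fun t s : 'I_k => omega ^+ (t * s)) k%:R) => [|t t']; last first.
  by rewrite sum_prim_root // !modn_small.
rewrite exprS ler_wpM2l ?ler0n //; apply: le_trans (phiP _ (fun j => y1 (lift ord0 j))).
apply: ler_sum => t _; rewrite lerXn2r ?nnegrE // normrM ler_piMl //.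
Qed.

Lemma chain_coef m : exists2 phi : word m -> C, forall w, `|phi w| = 1 &
  forall y : 'I_m -> 'I_k -> C, (forall j t, `|y j t| <= 1) ->
    `|\sum_w phi w * \prod_j y j (w j)| ^+ 2 <= k%:R ^+ m.+1.
Proof.
have [phi [phi1 phiP]] := chain_family m.
exists (phi (Ordinal k0)) => // y /phiP; apply: le_trans.
by rewrite (bigD1 (Ordinal k0)) //= lerDl sumr_ge0 // => s _; rewrite exprn_ge0.
Qed.

End ChainPolynomial.

(** * The chain polynomial as a holomorphic function on the n-dimensional polydisk *)

Section UpperBound.
Variables (R : realType) (n m k : nat).
Hypotheses (k0 : (0 < k)%N) (m0 : (0 < m)%N) (mkn : (m * k <= n)%N).
Local Notation C := R[i].
Local Notation word := {ffun 'I_m -> 'I_k}.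
Local Open Scope classical_set_scope.

Lemma card_variable : (#|{: 'I_m * 'I_k}| <= n)%N.
Proof. by rewrite card_prod !card_ord. Qed.

Definition variable (x : 'I_m * 'I_k) : 'I_n := widen_ord card_variable (enum_rank x).

Lemma variable_inj : injective variable.
Proof. by move=> x y /(congr1 val) /= /val_inj /enum_rank_inj. Qed.

Definition word_index (w : word) : multi_index n :=
  [ffun i => \sum_j (variable (j, w j) == i)]%N.

Lemma monom_word (z : 'I_n -> C) w : monom z (word_index w) = \prod_j z (variable (j, w j)).
Proof.
rewrite /monom; under [LHS]eq_bigr do rewrite ffunE -prodrXr.
rewrite exchange_big /=; apply: eq_bigr => j _.
rewrite (bigD1 (variable (j, w j))) //= eqxx expr1 big1 ?mulr1 // => i ij.
by rewrite eq_sym (negPf ij) expr0.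
Qed.

(** A word can be read off its support, because each variable remembers its position j. *)
Lemma word_index_inj : injective word_index.
Proof.
move=> w w' e; apply/ffunP => j.
have := congr1 (fun a : multi_index n => a (variable (j, w j))) e.
rewrite !ffunE (bigD1 j) //= eqxx => h.
have /existsP[j' /eqP /variable_inj [-> ->//]] : [exists j', variable (j', w' j') == variable (j, w j)].
apply: contraPT h => /existsPn h.
by rewrite [RHS]big1 // => j' _; rewrite (negPf (h j')).
Qed.

Lemma word_index_in_boxes w N : (m <= N)%N -> word_index w \in boxes n N.
Proof.
move=> mN; rewrite mem_boxes; apply/forallP => i; apply: leq_trans mN; rewrite ffunE.
by rewrite -[leqRHS]card_ord -sum1_card; apply: leq_sum => j _; apply: leq_b1.
Qed.

Variable phi : word -> C.
Hypothesis phi1 : forall w, `|phi w| = 1.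
Hypothesis phiP : forall y : 'I_m -> 'I_k -> C, (forall j t, `|y j t| <= 1) ->
    `|\sum_w phi w * \prod_j y j (w j)| ^+ 2 <= k%:R ^+ m.+1.
Variable nu : R.
Hypotheses (nu0 : 0 < nu) (nuP : nu ^+ 2 * k%:R ^+ m.+1 = 1).

(** At most one word contributes to the sum; [nu] brings the sup norm down to at most 1. *)
Definition chain (a : multi_index n) : C := nu%:C%C * \sum_(w | word_index w == a) phi w.

Lemma chain_word w : chain (word_index w) = nu%:C%C * phi w.
Proof.
rewrite /chain (big_pred1 w) // => w'.
by apply/eqP/eqP => [/word_index_inj|->].
Qed.

Lemma chain_eq0 N a : (m <= N)%N -> a \notin boxes n N -> chain a = 0.
Proof.
move=> mN aN; rewrite /chain big_pred0 ?mulr0 // => w.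
by apply: contraNF aN => /eqP <-; apply: word_index_in_boxes.
Qed.

Lemma chain_psum z N : (m <= N)%N -> box_psum chain z N =
  nu%:C%C * \sum_w phi w * \prod_j z (variable (j, w j)).
Proof.
move=> mN; have -> : box_psum chain z N = \sum_(a <- boxes n N) chain a * monom z a.
  by rewrite sum_boxes.
under eq_bigr => a _ do rewrite /chain -mulrA mulr_suml.
rewrite -mulr_sumr (exchange_big_dep xpredT) //=; congr (_ * _); apply: eq_bigr => w _.
rewrite -monom_word big_mkcond (bigD1_seq (word_index w)) ?word_index_in_boxes ?boxes_uniq //=.
rewrite eqxx big1 ?addr0 // => a aw.
by rewrite eq_sym (negPf aw).
Qed.

(** The support lies in the box of side m, so the box sums are constant from N = m on. *)
Lemma chain_holo : holo_unit_ball chain.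
Proof.
split=> z z1.
  pose g a := cmod (chain a * monom z a).
  have g0 a : 0 <= g a := cmod_ge0 _.
  apply: (@le_lt_trans _ _ (\sum_(a <- boxes n m) g a)%:E); last exact: ltry.
  apply: ge_ereal_sup => _ [X [finX _] <-].
  have [N NP] := finite_sum_le_boxes g0 finX.
  apply: le_trans (NP (maxn N m) (leq_maxl _ _)) _; rewrite lee_fin.
  rewrite (sum_boxes_le _ (leq_maxr N m)) [X in _ + X]big1 ?addr0 // => a am.
  by rewrite /g (chain_eq0 (leqnn m)) // mul0r; apply: complexI; rewrite -normcE normr0.
exists (nu%:C%C * \sum_w phi w * \prod_j z (variable (j, w j))); split.
  apply: cvg_near_cst; exists m => // N /= mN.
  exact: chain_psum.
set G := \sum_w _; have G_le : `|G| ^+ 2 <= k%:R ^+ m.+1.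
  by apply: (phiP (y := fun j t => z (variable (j, t)))) => j t; rewrite normcE lecR ltW.
have G2 : cmod G ^+ 2 <= k%:R ^+ m.+1.
  by rewrite -lecR !rmorphXn /= -normcE rmorph_nat.
rewrite -(@expr_le1 _ 2) ?cmod_ge0 // cmodM cmod_ger0 ?(ltW nu0) // exprMn -nuP.
by rewrite ler_wpM2l // exprn_ge0 // ltW.
Qed.

(** At the diagonal point (t, ..., t) all k^m monomials have the same modulus nu t^m. *)
Lemma chain_radius (p t r : R) : 0 < t < r ->
  (forall z, in_polydisk r z -> (p_majorant p chain z <= 1)%E) ->
  k%:R ^+ m * (nu * t ^+ m) `^ p <= 1.
Proof.
move=> /andP[t0 tr] zP.
have cmod_t : cmod (t%:C)%C = t by rewrite cmod_ger0 // ltW.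
have := zP (fun=> t%:C%C); rewrite /in_polydisk cmod_t => /(_ (fun=> tr)).
move=> maj; rewrite -lee_fin; apply: le_trans maj.
pose r' := [seq word_index w | w <- enum {: word}].
have r'_uniq : uniq r' by rewrite map_inj_uniq ?enum_uniq //; apply: word_index_inj.
apply: esum_ge; exists [set` r']; first by split => //; exact: finite_seq.
rewrite -fsbig_seq // sumEFin lee_fin big_map big_enum /=.
rewrite (eq_bigr (fun=> (nu * t ^+ m) `^ p)).
  by rewrite sumr_const card_ffun !card_ord -[leRHS]mulr_natl natrX.
move=> w _; congr (_ `^ _).
rewrite chain_word monom_word prodr_const card_ord !cmodM cmodX cmod_t cmod_ger0 ?(ltW nu0) //.
suff -> : cmod (phi w) = 1 by rewrite mulr1.
by apply: complexI; rewrite -normcE phi1.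
Qed.

End UpperBound.

(** * The upper bound for the Bohr radius, and the choice of m and k *)

Section RadiusUpperBound.
Variable R : realType.
Local Notation C := R[i].
Local Open Scope classical_set_scope.

(** Solving for t gives t <= K^(-(2-p)/(2p)) K^(1/(2m)), and the last factor is at most 2 because K
    <= 4^m. *)
Lemma chain_exponent_le (K p t : R) m : 1 <= K -> K <= 4 ^+ m -> 1 < p < 2 -> (0 < m)%N -> 0 <= t ->
  K ^+ m * (K `^ (- (m.+1%:R / 2)) * t ^+ m) `^ p <= 1 ->
  t <= 2 * K^-1 `^ ((2 - p) / (2 * p)).
Proof.
move=> K1 Km /andP[p1 p2] m0 t0 le1; rewrite leNgt; apply/negP => lt_t; move: le1; apply/negP; rewrite -ltNge.
have K0 : 0 < K by apply: lt_le_trans K1.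
have p0 : 0 < p by lra.
set e := (2 - p) / (2 * p) in lt_t *; set nu := K `^ _.
have nu0 : 0 < nu by rewrite powR_gt0.
(* At this value the left side equals (4^m / K)^(p/2) >= 1, and it is strictly increasing in t. *)
pose t1 := 2 * K `^ (- e).
have t1t : t1 < t.
  by apply: le_lt_trans lt_t; rewrite /t1 -[K^-1]powR_inv1 ?(ltW K0) // -powRrM mulN1r.
have t10 : 0 < t1 by rewrite mulr_gt0 ?powR_gt0.
apply: (@le_lt_trans _ _ (K ^+ m * (nu * t1 ^+ m) `^ p)); last first.
  rewrite ltr_pM2l ?exprn_gt0 // gt0_ltr_powR ?nnegrE ?mulr_ge0 ?exprn_ge0 ?(ltW nu0) ?(ltW t10) //.
  by rewrite ltr_pM2l // ltrXn2r // -?lt0n // ltW.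
have -> : K ^+ m * (nu * t1 ^+ m) `^ p = (4 ^+ m) `^ (p / 2) * K `^ (- (p / 2)).
  have -> : nu * t1 ^+ m = 2 ^+ m * K `^ (- (m.+1%:R / 2) - e * m%:R).
    rewrite powRD; last by rewrite (gt_eqF K0) implybT.
    rewrite /nu /t1 exprMn mulrCA; congr (_ * (_ * _)).
    by rewrite -powR_mulrn ?powR_ge0 // -powRrM mulNr.
  rewrite powRM ?exprn_ge0 ?powR_ge0 // -powRrM mulrCA.
  have -> : (4 ^+ m : R) = (2 ^+ m) `^ 2%:R.
    by rewrite powR_mulrn ?exprn_ge0 // -exprM mulnC exprM; congr (_ ^+ m); ring.
  rewrite -powRrM; congr (_ `^ _ * _); first by field.
  rewrite -powR_mulrn ?(ltW K0) // -powRD; last by rewrite (gt_eqF K0) implybT.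
  congr (_ `^ _); rewrite /e -natr1; field.
  by rewrite gt_eqF.
rewrite powRN ler_pdivlMr ?powR_gt0 // mul1r ge0_ler_powR ?nnegrE ?exprn_ge0 ?(ltW K0) //.
by rewrite divr_ge0 // ltW.
Qed.

Lemma bohr_radius_le n m k (p : R) :
  1 < p < 2 -> (0 < k)%N -> (0 < m)%N -> (m * k <= n)%N -> (k <= 4 ^ m)%N ->
  (bohr_radius n p <= (2 * (k%:R^-1 : R) `^ ((2 - p) / (2 * p)))%:E)%E.
Proof.
move=> p12 k0 m0 mkn k4; have [phi phi1 phiP] := chain_coef C k0 m.
have K0 : 0 < k%:R :> R by rewrite ltr0n.
pose nu : R := k%:R `^ (- (m.+1%:R / 2)).
have nu0 : 0 < nu by rewrite powR_gt0.
have nuP : nu ^+ 2 * k%:R ^+ m.+1 = 1.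
  rewrite -powR_mulrn ?(ltW nu0) // -powRrM -(powR_mulrn _ (ltW K0)) -powRD; last first.
    by rewrite (gt_eqF K0) implybT.
  by rewrite (_ : _ + _ = 0) ?powRr0 //; field.
apply: (@le_trans _ _ (bohr_radius_f p (chain mkn phi nu))).
  by apply: ereal_inf_lbound; exists (chain mkn phi nu) => //; apply: chain_holo.
apply: ge_ereal_sup => _ [r [r0 rP] <-]; rewrite lee_fin leNgt; apply/negP => lt_r.
set b := 2 * _ in lt_r.
have b0 : 0 <= b by rewrite mulr_ge0 ?powR_ge0.
(* A point strictly below r is needed, the polydisk being open. *)
pose t := (b + r) / 2.
have t0r : 0 < t < r by rewrite /t; apply/andP; split; lra.
have := chain_radius phi1 nu0 t0r rP.
move=> /(chain_exponent_le _ _ p12 m0 _) h.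
have : t <= b.
  apply: h; rewrite ?ler1n //; first by rewrite -natrX ler_nat.
  by case/andP: t0r => /ltW.
by rewrite /t; lra.
Qed.

(** With m = floor(log_2 n) and k = floor(n / m): k <= n < 2^(m+1) <= 4^m, while n <= 2 m k and m <=
    2 log n, the latter from log 2 >= 1/2. *)
Lemma chain_dims n : (1 < n)%N -> exists m k,
  [/\ (0 < k)%N, (0 < m)%N, (m * k <= n)%N & (k <= 4 ^ m)%N] /\
  (k%:R^-1 : R) <= 4 * (ln n%:R / n%:R).
Proof.
move=> n1; pose m := trunc_log 2 n; exists m, (n %/ m)%N.
have n0 : (0 < n)%N by apply: ltnW.
have m_le : (2 ^ m <= n)%N by rewrite trunc_logP.
have m_lt : (n < 2 ^ m.+1)%N by rewrite trunc_log_ltn.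
have m0 : (0 < m)%N by rewrite trunc_log_gt0.
have mn : (m <= n)%N by apply: leq_trans m_le; apply/ltnW/ltn_expl.
have k0 : (0 < n %/ m)%N by rewrite divn_gt0.
have mk : (m * (n %/ m) <= n)%N by rewrite mulnC leq_trunc_div.
split; first split=> //.
  apply: leq_trans (leq_div _ _) _; apply: leq_trans (ltnW m_lt) _.
  by rewrite (_ : 4 = 2 ^ 2)%N // -expnM leq_exp2l //; lia.
have nR : 0 < n%:R :> R by rewrite ltr0n.
have mR : 0 < m%:R :> R by rewrite ltr0n.
have kR : 0 < (n %/ m)%:R :> R by rewrite ltr0n.
have ln2 : 2^-1 <= ln 2 :> R.
  rewrite -(expRK 2^-1) ler_ln ?posrE ?expR_gt0 //.
  have E0 := expR_gt0 (2^-1 : R); have := expR_ge1Dx (- 2^-1 : R).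
  by rewrite expRN -(ler_pM2r E0) mulVf ?gt_eqF //; lra.
have m2L : m%:R <= 2 * ln n%:R :> R.
  have : ln (2 ^+ m) <= ln n%:R :> R by rewrite ler_ln ?posrE ?exprn_gt0 // -natrX ler_nat.
  rewrite lnXn // -[ln 2 *+ m]mulr_natl => h.
  have : m%:R * 2^-1 <= m%:R * ln 2 :> R by rewrite ler_pM2l.
  lra.
have n2 : n%:R <= 2 * m%:R * (n %/ m)%:R :> R.
  rewrite -!natrM ler_nat; have := ltn_pmod n m0; have := divn_eq n m.
  set q := (n %/ m)%N in k0 *; nia.
rewrite -[leLHS]mul1r ler_pdivrMr // !mulrA mulrAC ler_pdivlMr // mul1r.
apply: le_trans n2 _; rewrite ler_pM2r //; lra.
Qed.

End RadiusUpperBound.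

Theorem theorem1p4 (R : realType) (p : R) :
  1 < p < 2 ->
  exists C D : R, 0 < C /\ 0 < D /\
    forall n : nat, (1 < n)%N ->
      ((C * (ln (n%:R : R) / n%:R) `^ ((2 - p) / (2 * p)))%:E <= bohr_radius n p)%E /\
      (bohr_radius n p <= (D * (ln (n%:R : R) / n%:R) `^ ((2 - p) / (2 * p)))%:E)%E.
Proof.
move=> p12; have /andP[p1 p2] := p12.
set e := (2 - p) / (2 * p).
have e0 : 0 <= e by rewrite divr_ge0 ?mulr_ge0 //; lra.
(* 2^-10 is the largest [kap] with 16 kap <= 1/64, and 4^-1 comes from x = log n / (4 n). In the
   second constant, 2 comes from [chain_exponent_le] and 4 from 1 / k <= 4 log n / n. *)
exists (2^-1 ^+ 10 * 4^-1 `^ e), (2 * 4 `^ e).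
split; first by rewrite mulr_gt0 ?exprn_gt0 ?powR_gt0 // invr_gt0.
split; first by rewrite mulr_gt0 ?powR_gt0.
move=> n n1; have L0 : 0 <= ln n%:R / n%:R :> R.
  by rewrite divr_ge0 // ln_ge0 // ler1n ltnW.
split.
  have [x01 xn] := ln_div_bounds R n1.
  have kap0 : 0 < 2^-1 ^+ 10 :> R by rewrite exprn_gt0 // invr_gt0.
  have kap64 : 16 * 2^-1 ^+ 10 <= 64^-1 :> R by lra.
  have := bohr_radius_ge p12 x01 xn kap0 kap64.
  by rewrite -/e powRM ?invr_ge0 // (mulrC ((ln _ / _) `^ e)) mulrA.
have [m [k [[k0 m0 mk k4] kL]]] := chain_dims R n1.
apply: le_trans (bohr_radius_le p12 k0 m0 mk k4) _.
rewrite lee_fin -/e -mulrA ler_pM2l // -powRM // (ge0_ler_powR e0) ?nnegrE ?invr_ge0 //.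
by rewrite mulr_ge0.
Qed.
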